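(* Let $R=[a,b]\times[c,d]$, fix a net $\Delta$ on $R$ and $m,n\in\mathbb{N}$. The multi-valued mapping $\mathcal{T}^\Delta_{m,n}:\mathcal{C}(R)\rightrightarrows\mathcal{C}(R)$ defined by $$\mathcal{T}^\Delta_{m,n}(f)=\{f^\alpha_{\Delta,B_{m,n}}:\alpha\in\mathcal{C}(R)\text{ such that }\|\alpha\|_\infty<1\}$$ is a process.
   Context: Here $a<b$, $c<d$, and $\mathcal{C}(R)$ is the Banach space of continuous real functions on $R$ with supremum norm $\|\cdot\|_\infty$. Bernstein operator: for $m,n\in\mathbb{N}$ and $f\in\mathcal{C}(R)$, $$B_{m,n}(f)(x,y)=\frac{1}{(b-a)^m(d-c)^n}\sum_{i=0}^m\sum_{j=0}^n f\Big(a+\tfrac{i(b-a)}{m},c+\tfrac{j(d-c)}{n}\Big)\binom{m}{i}\binom{n}{j}(x-a)^i(b-x)^{m-i}(y-c)^j(d-y)^{n-j}.$$ Net: $\Delta=\{(x_i,y_j):0\le i\le N,\ 0\le j\le M\}$ with $a=x_0<x_1<\dots<x_N=b$ and $c=y_0<y_1<\dots<y_M=d$, $N,M\ge2$. Put $I=[a,b]$, $J=[c,d]$, $I_i=[x_{i-1},x_i]$, $J_j=[y_{j-1},y_j]$, $R_{ij}=I_i\times J_j$. For $1\le i\le N$, $u_i:I\to I_i$ is a contraction that is a homeomorphism onto $I_i$, with $u_i(x_0)=x_{i-1}$, $u_i(x_N)=x_i$ if $i$ is odd and $u_i(x_0)=x_i$, $u_i(x_N)=x_{i-1}$ if $i$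 is even. For $1\le j\le M$, $v_j:J\to J_j$ is a contraction that is a homeomorphism onto $J_j$, with $v_j(y_0)=y_{j-1}$, $v_j(y_M)=y_j$ if $j$ is odd and $v_j(y_0)=y_j$, $v_j(y_M)=y_{j-1}$ if $j$ is even. The maps $u_i,v_j$ are fixed for the net. Put $Q_{ij}(x,y)=(u_i^{-1}(x),v_j^{-1}(y))$ for $(x,y)\in R_{ij}$. $\alpha$-fractal function: for $f\in\mathcal{C}(R)$ and $\alpha\in\mathcal{C}(R)$ with $\|\alpha\|_\infty<1$, $f^\alpha_{\Delta,B_{m,n}}$ is the unique function in $\mathcal{C}(R)$ satisfying, for all $\boldsymbol{x}\in R_{ij}$, $1\le i\le N$, $1\le j\le M$, $$f^\alpha_{\Delta,B_{m,n}}(\boldsymbol{x})=f(\boldsymbol{x})+\alpha(\boldsymbol{x})f^\alpha_{\Delta,B_{m,n}}(Q_{ij}(\boldsymbol{x}))-\alpha(\boldsymbol{x})B_{m,n}(f)(Q_{ij}(\boldsymbol{x})).$$ It is known that this function exists and is unique and that $f\mapsto f^\alpha_{\Delta,B_{m,n}}$ is bounded and linear. A multi-valued mapping $T:X\rightrightarrows Y$ between normed spaces is a process if $\lambda T(x)=T(\lambda x)$ for all $x\in X$, $\lambda>0$, and $0\in T(0)$. *)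

(* Defs.v *)
From HB Require Import structures.
From mathcomp Require Import all_boot all_order all_algebra.
From mathcomp Require Import all_classical all_reals all_analysis.

Set Implicit Arguments.
Unset Strict Implicit.
Unset Printing Implicit Defensive.

Import Order.TTheory GRing.Theory Num.Theory.
Import numFieldNormedType.Exports.

Local Open Scope classical_set_scope.
Local Open Scope ring_scope.

Definition rect (R : realType) (a b c d : R) : set (R * R) :=
  `[a, b] `*` `[c, d].

(* A continuous function on the rectangle is represented by its extension by
   zero to the plane, so that Leibniz equality is equality on the rectangle. *)
Definition crect_pred (R : realType) (a b c d : R) : {pred R * R -> R} :=
  mem [set f : R * R -> R | {within rect a b c d, continuous f} /\
                            f \_ (rect a b c d) = f].

Record crect (R : realType) (a b c d : R) := CRect {
  crect_fun :> R * R -> R;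
  crect_funP : crect_fun \in crect_pred a b c d }.

HB.instance Definition _ (R : realType) (a b c d : R) :=
  [isSub of crect a b c d for @crect_fun R a b c d].
HB.instance Definition _ (R : realType) (a b c d : R) :=
  [Choice of crect a b c d by <:].

Section crect_normed.
Context {R : realType} (a b c d : R).
Local Notation K := (rect a b c d).
Local Notation C := (crect a b c d).

Lemma crect_submod_closed : submod_closed (crect_pred a b c d).
Proof.
split.
  rewrite inE; split; first by move=> p; exact: cvg_cst.
  by apply/funext => p; rewrite patchE; case: ifP.
move=> k f g; rewrite !inE => -[cf f0] [cg g0]; split.
  move=> p; apply: (@continuousD R R^o (subspace K)) (cg p).
  by apply: continuousM; [exact: cvg_cst | exact: cf].
apply/funext => p; have := congr1 (fun h => h p) f0.
have := congr1 (fun h => h p) g0; rewrite !patchE; case: ifP => //= _ g_p f_p.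
by rewrite -[RHS]/(k * f p + g p) -f_p -g_p mulr0 addr0.
Qed.

HB.instance Definition _ :=
  GRing.isSubmodClosed.Build R (R * R -> R) (crect_pred a b c d)
    crect_submod_closed.
HB.instance Definition _ := [SubChoice_isSubLmodule of C by <:].

Lemma crect_continuous (f : C) : {within K, continuous f}.
Proof. by have := crect_funP f; rewrite inE => -[]. Qed.

Lemma crect_out (f : C) p : ~ K p -> f p = 0.
Proof.
move=> Kp; have := crect_funP f; rewrite inE => -[_ <-].
by rewrite patchE memNset.
Qed.

Definition crect_norm (f : C) : R := sup [set `|f p| | p in K].

Lemma crect_bounded (f : C) : has_ubound [set `|f p| | p in K].
Proof.
have cK : compact K by apply: compact_setX; exact: segment_compact.
have := continuous_compact (@crect_continuous f) cK.
move=> /compact_bounded[M [_ Mf]]; exists (M + 1) => _ [p Kp <-].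
by apply: (Mf (M + 1)); [rewrite ltrDl | exists p].
Qed.

Lemma ler_crect_norm (f : C) p : K p -> `|f p| <= crect_norm f.
Proof.
by move=> Kp; apply: ub_le_sup; [exact: crect_bounded | exists p].
Qed.

Lemma crect_norm_ge0 (f : C) : 0 <= crect_norm f.
Proof.
have [[p Kp]|/set0P/negP/negPn/eqP K0] := pselect (K !=set0).
  exact: le_trans (ler_crect_norm f Kp).
by rewrite /crect_norm K0 image_set0 sup0.
Qed.

Lemma crect_norm_le (f : C) M :
  0 <= M -> (forall p, K p -> `|f p| <= M) -> crect_norm f <= M.
Proof.
move=> M0 fM; have [[p Kp]|/set0P/negP/negPn/eqP K0] := pselect (K !=set0).
  by apply: ge_sup; [exists `|f p|, p | move=> _ [q Kq <-]; exact: fM].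
by rewrite /crect_norm K0 image_set0 sup0.
Qed.

Lemma crect_ler_normD (f g : C) :
  crect_norm (f + g) <= crect_norm f + crect_norm g.
Proof.
apply: crect_norm_le; first by rewrite addr_ge0// crect_norm_ge0.
move=> p Kp; rewrite -[(f + g : C) p]/(f p + g p).
by rewrite (le_trans (ler_normD _ _))// lerD// ler_crect_norm.
Qed.

Lemma crect_normrZ (k : R) (f : C) : crect_norm (k *: f) = `|k| * crect_norm f.
Proof.
have le l (g : C) : crect_norm (l *: g) <= `|l| * crect_norm g.
  apply: crect_norm_le; first by rewrite mulr_ge0// crect_norm_ge0.
  move=> p Kp; rewrite -[(l *: g : C) p]/(l * g p) normrM.
  by rewrite ler_wpM2l// ler_crect_norm.
apply/eqP; rewrite eq_le le/=.
have [->|k0] := eqVneq k 0; first by rewrite normr0 mul0r crect_norm_ge0.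
have := le k^-1 (k *: f); rewrite scalerA mulVf// scale1r normfV.
by rewrite ler_pdivlMl// normr_gt0.
Qed.

Lemma crect_normr0_eq0 (f : C) : crect_norm f = 0 -> f = 0.
Proof.
move=> f0; apply/val_inj/funext => p /=; rewrite -[RHS]/(0 : R).
have [Kp|/crect_out//] := pselect (K p).
by apply/normr0_eq0/le_anti; rewrite normr_ge0 -f0 ler_crect_norm.
Qed.

HB.instance Definition _ :=
  Lmodule_isNormed.Build R C crect_ler_normD crect_normrZ crect_normr0_eq0.

End crect_normed.

Definition homeomorphism_onto (R : realType) (A B : set R) (f : R -> R) :=
  [/\ set_bij A B f, {within A, continuous f} &
      {within B, continuous (pinv A f)}].

(* One coordinate of a net together with its fixed family of contractions.
   Points are indexed by 0..N and maps by 1..N; the values of the two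
   sequences at other indices are irrelevant. *)
Record axis_net (R : realType) (a b : R) := AxisNet {
  net_size : nat;
  net_pt : nat -> R;
  net_map : nat -> R -> R;
  net_cell := fun i => `[net_pt i.-1, net_pt i];
  net_size_ge2 : (2 <= net_size)%N;
  net_pt_first : net_pt 0 = a;
  net_pt_last : net_pt net_size = b;
  net_pt_lt : forall i, (i < net_size)%N -> net_pt i < net_pt i.+1;
  net_map_homeo : forall i, (1 <= i <= net_size)%N ->
    homeomorphism_onto `[a, b] [set` net_cell i] (net_map i);
  net_map_contraction : forall i, (1 <= i <= net_size)%N ->
    exists2 k : R, 0 <= k < 1 & k.-lipschitz_(`[a, b]) (net_map i);
  net_map_ends : forall i, (1 <= i <= net_size)%N ->
    if odd i then
      net_map i (net_pt 0) = net_pt i.-1 /\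
      net_map i (net_pt net_size) = net_pt i
    else
      net_map i (net_pt 0) = net_pt i /\
      net_map i (net_pt net_size) = net_pt i.-1 }.

Record net (R : realType) (a b c d : R) := Net {
  net_x : axis_net a b;
  net_y : axis_net c d }.

Definition net_rect (R : realType) (a b c d : R) (D : net a b c d)
    (i j : nat) : set (R * R) :=
  [set` net_cell (net_x D) i] `*` [set` net_cell (net_y D) j].

Definition net_inv (R : realType) (a b c d : R) (D : net a b c d)
    (i j : nat) (p : R * R) : R * R :=
  (pinv `[a, b] (net_map (net_x D) i) p.1,
   pinv `[c, d] (net_map (net_y D) j) p.2).

Definition bernstein (R : realType) (a b c d : R) (m n : nat)
    (f : crect a b c d) (p : R * R) : R :=
  ((b - a) ^+ m * (d - c) ^+ n)^-1 *
  \sum_(i < m.+1) \sum_(j < n.+1)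
    f (a + i%:R * (b - a) / m%:R, c + j%:R * (d - c) / n%:R) *
    'C(m, i)%:R * 'C(n, j)%:R *
    (p.1 - a) ^+ i * (b - p.1) ^+ (m - i) *
    (p.2 - c) ^+ j * (d - p.2) ^+ (n - j).

Definition self_referential (R : realType) (a b c d : R) (D : net a b c d)
    (m n : nat) (f alpha g : crect a b c d) : Prop :=
  forall i j, (1 <= i <= net_size (net_x D))%N ->
    (1 <= j <= net_size (net_y D))%N ->
    forall p, net_rect D i j p ->
      g p = f p + alpha p * g (net_inv D i j p) -
            alpha p * bernstein m n f (net_inv D i j p).

(* The solution of the self-referential equation exists and is unique when
   a < b, c < d, 0 < m, 0 < n and `|alpha| < 1; 0 is a default value. *)
Definition fractal_function (R : realType) (a b c d : R) (D : net a b c d)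
    (m n : nat) (f alpha : crect a b c d) : crect a b c d :=
  xget 0 [set g | self_referential D m n f alpha g].

Definition fractal_mapping (R : realType) (a b c d : R) (D : net a b c d)
    (m n : nat) (f : crect a b c d) : set (crect a b c d) :=
  [set fractal_function D m n f alpha | alpha in
     [set alpha : crect a b c d | `|alpha| < 1]].

Definition is_process (R : realType) (X Y : normedModType R)
    (T : X -> set Y) : Prop :=
  (forall (x : X) (l : R), 0 < l -> [set l *: y | y in T x] = T (l *: x)) /\
  T 0 0.

(* Main.v *)
Require Import Defs.
From mathcomp Require Import all_boot all_order all_algebra.
From mathcomp Require Import all_classical all_reals all_analysis.
From mathcomp Require Import ring.
Import Order.TTheory GRing.Theory Num.Theory.
Local Open Scope ring_scope.

(** The self-referential equation is linear in the pair [(f, g)], so scaling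
    maps its solutions for [f] onto its solutions for [l f]. The difference
    [h] of two solutions satisfies [h = alpha (h \o Q)], hence
    [`|h| <= `|alpha| `|h|], so that [h = 0] when [`|alpha| < 1].
    Existence of a solution plays no role: without one for [f] there is none
    for [l f] with [l != 0], and both default values are [0]. *)

(** Descending through the net points, the first one lying strictly below [x] is the left end of a
    cell containing [x]; if there is none, [x] is the first net point and the first cell serves. *)
Lemma axis_net_cover {R : realType} {a b : R} (D : axis_net a b) {x : R} :
  x \in `[a, b] ->
  exists2 i, (1 <= i <= net_size D)%N & x \in net_cell D i.
Proof.
rewrite in_itv/= => /andP[ax xb].
have x0 : net_pt D 0 <= x by rewrite net_pt_first.
have xN : x <= net_pt D (net_size D) by rewrite net_pt_last.
have n0 : (0 < net_size D)%N by exact: ltnW (net_size_ge2 D).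
move: (leqnn (net_size D)) n0 xN.
(* Only the upper bound on [x] moves with [k]; the range allowed for the cell index keeps the full
   [net_size D]. *)
elim: {1 3 4}(net_size D) => // k IH kN _ xk.
have [xk1|xk1] := leP x (net_pt D k); last first.
  by exists k.+1; rewrite // in_itv/= (ltW xk1).
case: k IH kN xk xk1 => [|k] IH kN xk xk1; last by apply: IH => //; exact: ltnW.
by exists 1%N; rewrite // in_itv/= x0.
Qed.

Section fractal.
Set Implicit Arguments.
Unset Strict Implicit.
Context {R : realType} {a b c d : R}.
Implicit Types (D : net a b c d) (m n : nat) (f g alpha : crect a b c d).

Lemma crectZE (l : R) f (p : R * R) : (l *: f) p = l * f p.
Proof. by []. Qed.

Lemma crectBE f g (p : R * R) : (f - g) p = f p - g p.
Proof. by []. Qed.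

Lemma net_rect_cover D (p : R * R) : rect a b c d p ->
  exists i j, [/\ (1 <= i <= net_size (net_x D))%N,
    (1 <= j <= net_size (net_y D))%N & net_rect D i j p].
Proof.
move=> [/= px py]; have [i iN pi] := axis_net_cover (net_x D) px.
by have [j jM pj] := axis_net_cover (net_y D) py; exists i, j.
Qed.

Lemma net_inv_rect D (i j : nat) (p : R * R) :
  (1 <= i <= net_size (net_x D))%N -> (1 <= j <= net_size (net_y D))%N ->
  net_rect D i j p -> rect a b c d (net_inv D i j p).
Proof.
move=> /net_map_homeo[[_ _ sx] _ _] /net_map_homeo[[_ _ sy] _ _] [/= px py].
(* Since each map is onto its cell, its [pinv] sends the cell back into the domain interval. *)
by split; [apply: (surjpinv_image_sub sx); exists p.1
          |apply: (surjpinv_image_sub sy); exists p.2].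
Qed.

Lemma bernsteinZ m n (l : R) f p :
  bernstein m n (l *: f) p = l * bernstein m n f p.
Proof.
rewrite /bernstein mulrCA; congr (_ * _).
rewrite mulr_sumr; apply: eq_bigr => i _.
rewrite mulr_sumr; apply: eq_bigr => j _.
by rewrite crectZE -!mulrA.
Qed.

Lemma self_referentialZ D m n (l : R) f alpha g :
  self_referential D m n f alpha g ->
  self_referential D m n (l *: f) alpha (l *: g).
Proof.
move=> fg i j iN jM p pij; rewrite bernsteinZ.
rewrite !crectZE (fg i j iN jM p pij); ring.
Qed.

Lemma self_referential_unique D m n f alpha g1 g2 : `|alpha| < 1 ->
  self_referential D m n f alpha g1 -> self_referential D m n f alpha g2 ->
  g1 = g2.
Proof.
move=> alpha1 fg1 fg2; apply/eqP; rewrite -subr_eq0 -normr_le0.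
set h := g1 - g2.
suff hle : `|h| <= `|alpha| * `|h|.
  by rewrite leNgt; apply: contraTN hle => h0; rewrite -ltNge gtr_pMl.
apply: crect_norm_le => [|p Kp]; first by rewrite mulr_ge0.
have [i [j [iN jM pij]]] := net_rect_cover D Kp.
(* The [f] and Bernstein terms are common to both equations and cancel. *)
have -> : h p = alpha p * h (net_inv D i j p).
  rewrite !crectBE (fg1 i j iN jM p pij) (fg2 i j iN jM p pij).
  ring.
rewrite normrM ler_pM//; first exact: ler_crect_norm.
exact: (ler_crect_norm _ (net_inv_rect iN jM pij)).
Qed.

(** Uniqueness forces the solution chosen by [xget] to be [g]. *)
Lemma fractal_function_eq D m n f alpha g : `|alpha| < 1 ->
  self_referential D m n f alpha g -> fractal_function D m n f alpha = g.
Proof.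
move=> alpha1 fg; apply: xget_unique => // g' fg'.
exact: (self_referential_unique alpha1 fg' fg).
Qed.

Lemma fractal_functionZ D m n (l : R) f alpha : l != 0 -> `|alpha| < 1 ->
  fractal_function D m n (l *: f) alpha = l *: fractal_function D m n f alpha.
Proof.
move=> l0 alpha1; rewrite {2}/fractal_function.
case: xgetP => [g _ /= fg|nofg].
  exact: (fractal_function_eq alpha1 (self_referentialZ l fg)).
rewrite scaler0 /fractal_function; case: xgetP => // g _ /= lfg.
(* Scaling by [l^-1] would turn a solution [g] for [l *: f] into one for [f], contradicting
   [nofg]. *)
case: (nofg (l^-1 *: g)); rewrite /= -(scalerK l0 f).
exact: self_referentialZ.
Qed.

End fractal.

Theorem theorem3p6 (R : realType) (a b c d : R) (D : net a b c d) (m n : nat) :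
  a < b -> c < d -> (0 < m)%N -> (0 < n)%N ->
  is_process (fractal_mapping D m n).
Proof.
move=> _ _ _ _; split=> [f l l0|].
  apply/seteqP; split=> [_ [_ [alpha alpha1 <-] <-]|_ [alpha alpha1 <-]].
    (* Both inclusions keep the same [alpha]. *)
    by exists alpha => //; apply: fractal_functionZ; rewrite ?gt_eqF.
  exists (fractal_function D m n f alpha); first by exists alpha.
  by apply/esym/fractal_functionZ; rewrite ?gt_eqF.
have norm0 : `|0 : crect a b c d| < 1 by rewrite normr0.
(* With [alpha] equal to [0], both terms carrying [alpha] vanish, so the zero function solves the
   equation for [f] equal to [0]. *)
exists 0 => //; apply: fractal_function_eq => // i j _ _ p _.
by rewrite -![(0 : crect a b c d) _]/(0 : R) !mul0r subr0 addr0.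
Qed.
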